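(* Let $k$ be an algebraically closed field, let $A$ be a basic finite-dimensional $k$-algebra with $n$ isomorphism classes of simple modules $S_1,\dots,S_n$, and let $\leqslant$ be a linear order on $[n]=\{1,\dots,n\}$. Then the following are equivalent: (1) For every $i \in [n]$, every composition factor of the standard module $\Delta_i$ is isomorphic to $S_i$. (2) For every $i \in [n]$, the proper standard module $\overline{\Delta}_i$ is simple, i.e. isomorphic to $S_i$. (3) The associated category $\mathcal{A}$ of $A$ is a directed category with respect to $\leqslant$.
   Context: All modules are finitely generated left modules. Let $e_1,\dots,e_n$ be primitive orthogonal idempotents of $A$ with sum $1$, let $P_i = Ae_i$ be the corresponding indecomposable projective modules, and $S_i$ the top of $P_i$. The standard module $\Delta_i$ (with respect to $\leqslant$) is the largest quotient of $P_i$ all of whose composition factors $S_j$ satisfy $j \leqslant i$. The proper standard module $\overline{\Delta}_i$ is the largest quotient of $P_i$ all of whose composition factors $S_j$ satisfy $j<i$, except for a single copy of $S_i$ (its top). (These make sense for any $A$; $A$ is not assumed to be standardly stratified.) The associated category $\mathcal{A}$ of $A$ is the $k$-linear category with objects $1,\dots,n$ (corresponding to $e_1,\dots,e_n$), morphism spaces $\mathcal{A}(i,j)=e_jAe_i$, and composition given by multiplication in $A$. It is directed with respect to $\leqslant$ if $\mathcal{A}(i,j)\neq 0$ implies $i\leqslant j$. *)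

(* Defs.v *)
From HB Require Import structures.
From mathcomp Require Import all_boot all_order all_algebra all_field.
From mathcomp Require Import boolp.

Set Implicit Arguments.
Unset Strict Implicit.
Unset Printing Implicit Defensive.

Import GRing.Theory.
Local Open Scope ring_scope.
Local Open Scope quotient_scope.

Section Modules.
Variable R : nzRingType.

(* MathComp's [submodClosed M] does not carry closure under opposites, which
   the quotient construction needs. *)
Record submod (M : lmodType R) := Submod {
  submod_pred :> {pred M};
  submodP : submod_closed submod_pred
}.

HB.instance Definition _ (M : lmodType R) (N : submod M) :=
  GRing.isSubmodClosed.Build R M (submod_pred N)
    (GRing.submod_closed_semi (submodP N)).

Section SubQuot.
Variables (M : lmodType R) (N : submod M).

Record sub_mod := SubMod { sub_val : M; _ : sub_val \in N }.

HB.instance Definition _ := [isSub for sub_val].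
HB.instance Definition _ := [Choice of sub_mod by <:].
HB.instance Definition _ := [SubChoice_isSubLmodule of sub_mod by <:].

Definition quot_mod : Type := Quotient.quot (submod_pred N).

HB.instance Definition _ := ZmodQuotient.on quot_mod.

Definition quot_scale (a : R) (x : quot_mod) : quot_mod :=
  \pi_quot_mod (a *: repr x).

Lemma pi_eqP (x y : M) : reflect (x = y %[mod quot_mod]) (x - y \in N).
Proof. by rewrite Quotient.idealrBE; apply: eqP. Qed.

Lemma quot_scaleE a (x : M) :
  quot_scale a (\pi_quot_mod x) = \pi_quot_mod (a *: x).
Proof.
by apply/pi_eqP; rewrite -scalerBr rpredZ //; apply/pi_eqP; rewrite reprK.
Qed.

Fact quot_scaleA a b x : quot_scale a (quot_scale b x) = quot_scale (a * b) x.
Proof. by elim/quotW: x => x; rewrite (quot_scaleE b) !quot_scaleE scalerA. Qed.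

Fact quot_scale1 : left_id 1 quot_scale.
Proof. by elim/quotW=> x; rewrite quot_scaleE scale1r. Qed.

Fact quot_scaleDr : right_distributive quot_scale +%R.
Proof.
move=> a; elim/quotW=> x; elim/quotW=> y.
by rewrite -raddfD !quot_scaleE scalerDr raddfD.
Qed.

Fact quot_scaleDl x : {morph quot_scale^~ x : a b / a + b}.
Proof. by move=> a b; elim/quotW: x => x; rewrite !quot_scaleE scalerDl raddfD. Qed.

HB.instance Definition _ := GRing.Zmodule_isLmodule.Build R quot_mod
  quot_scaleA quot_scale1 quot_scaleDr quot_scaleDl.

End SubQuot.

Section Subquotient.
Variables (M : lmodType R) (U V : submod M).

Fact restr_closed : submod_closed [pred x : sub_mod U | \val x \in V].
Proof.
split=> [|a x y]; rewrite !inE ?linear0 ?rpred0 //= => xV yV.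
by rewrite rpredD // rpredZ.
Qed.

(* U / (U :&: V), which is U / V whenever V is contained in U *)
Definition subquot : lmodType R := quot_mod (Submod restr_closed).

End Subquotient.

Definition iso_mod (M X : lmodType R) : Prop :=
  exists f : {linear M -> X}, bijective f.

Definition simple_mod (M : lmodType R) : Prop :=
  (exists x : M, x <> 0) /\
  forall N : submod M, (forall x, x \in N -> x = 0) \/ (forall x, x \in N).

Definition maximal_submod (M : lmodType R) (N : submod M) : Prop :=
  (exists x, x \notin N) /\
  forall N' : submod M, {subset N <= N'} ->
    {subset N' <= N} \/ (forall x, x \in N').

Section Intersection.
Variables (M : lmodType R) (Q : submod M -> Prop).

Fact cap_closed : submod_closed [pred x : M | `[< forall N, Q N -> x \in N >]].
Proof.
split=> [|a x y]; rewrite !inE; first by apply/asboolP => N _; apply: rpred0.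
move=> /asboolP xN /asboolP yN; apply/asboolP => N QN.
by rewrite rpredD ?rpredZ ?xN ?yN.
Qed.

Definition cap_submod : submod M := Submod cap_closed.

Lemma cap_submod_least (K : submod M) :
  Q K -> (forall N, Q N -> {subset K <= N}) -> cap_submod =i K.
Proof.
move=> QK leK x; apply/asboolP/idP => [/(_ K QK)//|Kx N QN]; exact: leK Kx.
Qed.

End Intersection.

Definition top_mod (M : lmodType R) : lmodType R :=
  quot_mod (cap_submod (@maximal_submod M)).

(* The largest quotient of M satisfying T is M / K for K the least submodule
   with T (M / K), which is the intersection of all N with T (M / N) by
   cap_submod_least. *)
Definition largest_quot (M : lmodType R) (T : lmodType R -> Prop) :
    lmodType R :=
  quot_mod (cap_submod (fun N : submod M => T (quot_mod N))).

(* 0 = N 0 <= N 1 <= ... <= N l = M; the values of N beyond l are irrelevant *)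
Definition comp_series (M : lmodType R) (l : nat) (N : nat -> submod M) :=
  [/\ forall x, x \in N 0 -> x = 0,
      forall x, x \in N l &
      forall t, (t < l)%N ->
        {subset N t <= N t.+1} /\ simple_mod (subquot (N t.+1) (N t))].

Definition comp_factor (M X : lmodType R) : Prop :=
  exists l (N : nat -> submod M), comp_series l N /\
    exists2 t, (t < l)%N & iso_mod (subquot (N t.+1) (N t)) X.

(* X occurs exactly m times in some composition series of M; by Jordan-Hoelder
   m does not depend on the series. *)
Definition comp_mult (M X : lmodType R) (m : nat) : Prop :=
  exists l (N : nat -> submod M), comp_series l N /\
    #|[set t : 'I_l | `[< iso_mod (subquot (N t.+1) (N t)) X >]]| = m.

End Modules.

Section Algebra.
Variables (k : fieldType) (A : falgType k).

Definition primitive_idempotent (e : A) : Prop :=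
  [/\ e * e = e, e <> 0 &
      forall f g : A, f * f = f -> g * g = g -> f * g = 0 -> g * f = 0 ->
        e = f + g -> f = 0 \/ g = 0].

Definition complete_primitive n (e : 'I_n -> A) : Prop :=
  [/\ forall i, primitive_idempotent (e i),
      forall i j, i != j -> e i * e j = 0 &
      \sum_i e i = 1].

Fact lideal_closed (e : A) :
  submod_closed [pred x : A^o | `[< exists a : A, x = a * e >]].
Proof.
split=> [|a x y]; rewrite !inE; first by apply/asboolP; exists 0; rewrite mul0r.
move=> /asboolP[b ->] /asboolP[c ->]; apply/asboolP; exists (a * b + c).
by rewrite mulrDl -mulrA.
Qed.

Definition Pmod (e : A) : lmodType A := sub_mod (Submod (lideal_closed e)).

Definition Smod (e : A) : lmodType A := top_mod (Pmod e).

(* A is basic, expressed through a complete family of primitive orthogonal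
   idempotents: the indecomposable projectives A e_i are pairwise
   non-isomorphic. *)
Definition basic n (e : 'I_n -> A) : Prop :=
  forall i j, iso_mod (Pmod (e i)) (Pmod (e j)) -> i = j.

Section Standard.
Variables (n : nat) (e : 'I_n -> A) (r : rel 'I_n).

Definition Delta (i : 'I_n) : lmodType A :=
  largest_quot (Pmod (e i)) (fun M =>
    forall j, comp_factor M (Smod (e j)) -> r j i).

Definition properDelta (i : 'I_n) : lmodType A :=
  largest_quot (Pmod (e i)) (fun M =>
    comp_mult M (Smod (e i)) 1 /\
    forall j, j != i -> comp_factor M (Smod (e j)) -> r j i).

End Standard.
End Algebra.

Definition linear_order n (r : rel 'I_n) : Prop :=
  [/\ reflexive r, antisymmetric r, transitive r & total r].

Record lin_category (k : fieldType) := LinCategory {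
  obj : Type;
  hom : obj -> obj -> lmodType k;
  idm : forall x, hom x x;
  comp : forall x y z, hom y z -> hom x y -> hom x z;
  _ : forall w x y z (h : hom y z) (g : hom x y) (f : hom w x),
        comp h (comp g f) = comp (comp h g) f;
  _ : forall x y (f : hom x y), comp (idm y) f = f;
  _ : forall x y (f : hom x y), comp f (idm x) = f;
  _ : forall x y z (g : hom y z), linear (fun f : hom x y => comp g f);
  _ : forall x y z (f : hom x y), linear (fun g : hom y z => comp g f)
}.

Definition directed (k : fieldType) (C : lin_category k) (r : rel (obj C)) :=
  forall i j : obj C, (exists f : hom i j, f <> 0) -> r i j.
Arguments directed {k} C r.

Section AssociatedCategory.
Variables (k : fieldType) (A : falgType k) (n : nat) (e : 'I_n -> A).
Hypothesis he : complete_primitive e.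

(* e_j A e_i *)
Definition corner (i j : 'I_n) : {vspace A} :=
  limg (amulr (e i) \o amull (e j))%VF.

Lemma cornerP i j x : reflect (exists a, x = e j * a * e i) (x \in corner i j).
Proof.
apply: (iffP memv_imgP) => [[a _ ->]|[a ->]]; exists a; rewrite ?memvf //.
  by rewrite comp_lfunE lfunE /= lfunE.
by rewrite comp_lfunE lfunE /= lfunE.
Qed.

Let e_idem i : e i * e i = e i.
Proof. by case: he => /(_ i)[]. Qed.

Fact acat_id_subproof i : e i \in corner i i.
Proof. by apply/cornerP; exists 1; rewrite mulr1 e_idem. Qed.

Fact acat_comp_subproof x y z (g : subvs_of (corner y z))
  (f : subvs_of (corner x y)) : vsval g * vsval f \in corner x z.
Proof.
have [/cornerP[b ->] /cornerP[a ->]] := (subvsP g, subvsP f).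
by apply/cornerP; exists (b * e y * e y * a); rewrite !mulrA.
Qed.

Definition acat_id i : subvs_of (corner i i) := Subvs (acat_id_subproof i).

Definition acat_comp x y z (g : subvs_of (corner y z))
  (f : subvs_of (corner x y)) : subvs_of (corner x z) :=
  Subvs (acat_comp_subproof g f).

Fact acat_compA w x y z (h : subvs_of (corner y z))
    (g : subvs_of (corner x y)) (f : subvs_of (corner w x)) :
  acat_comp h (acat_comp g f) = acat_comp (acat_comp h g) f.
Proof. by apply: val_inj; rewrite /= mulrA. Qed.

Fact acat_comp1 x y (f : subvs_of (corner x y)) : acat_comp (acat_id y) f = f.
Proof.
apply: val_inj; rewrite /=; have /cornerP[a ->] := subvsP f.
by rewrite !mulrA e_idem.
Qed.

Fact acat_1comp x y (f : subvs_of (corner x y)) : acat_comp f (acat_id x) = f.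
Proof.
apply: val_inj; rewrite /=; have /cornerP[a ->] := subvsP f.
by rewrite -!mulrA e_idem.
Qed.

Fact acat_linear_r x y z (g : subvs_of (corner y z)) :
  linear (fun f : subvs_of (corner x y) => acat_comp g f).
Proof. by move=> c f f'; apply: val_inj; rewrite /= mulrDr scalerAr. Qed.

Fact acat_linear_l x y z (f : subvs_of (corner x y)) :
  linear (fun g : subvs_of (corner y z) => acat_comp g f).
Proof. by move=> c g g'; apply: val_inj; rewrite /= mulrDl scalerAl. Qed.

Definition associated_category : lin_category k :=
  @LinCategory k 'I_n (fun i j => subvs_of (corner i j)) acat_id acat_comp
    acat_compA acat_comp1 acat_1comp acat_linear_r acat_linear_l.

End AssociatedCategory.

(* Main.v *)
From HB Require Import structures.
Require Import Defs.
From mathcomp Require Import all_boot all_order all_algebra all_field.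
From mathcomp Require Import boolp.

(* Write J_i for the unique maximal submodule of P_i = A e_i; it exists because
   e_i A e_i is local, by Fitting's lemma.  For a quotient P_i / N, the simple
   module S_j is a composition factor iff e_j P_i is not contained in N.

   (1) => (2): if P_i / N is a candidate for the proper standard module, then it
   is a quotient of Delta_i, so all its factors are S_i; there is only one, so
   N = J_i.

   (2) => (3): by induction from the top of the order, e_j A e_l = 0 for all
   j < l with l > i.  For j < i let I be the radical of e_i A e_i and let N be
   the submodule of those z in J_i with e_j A z contained in e_j A e_i I.  It
   contains e_i J_i and e_l P_i for l > i, so that P_i / N is a candidate for
   the proper standard module.  Since the latter is simple, N = J_i, hence
   e_j A e_i = e_j A e_i I, and Nakayama's lemma gives e_j A e_i = 0.

   (3) => (1): if S_j is a factor of Delta_i, then j <= i by definition and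
   e_j A e_i <> 0, so i <= j. *)

Set Implicit Arguments.
Unset Strict Implicit.
Unset Printing Implicit Defensive.
Import GRing.Theory.
Local Open Scope ring_scope.
Local Open Scope quotient_scope.

(** * Submodules, quotients and composition series over a ring *)

Section Modules.
Variable R : nzRingType.

Section Images.
Variables (M X : lmodType R) (f : {linear M -> X}).

Fact preim_closed (N : submod X) : submod_closed [pred x : M | f x \in N].
Proof.
split=> [|a x y]; rewrite !inE ?linear0 ?rpred0 // linearP => xN yN.
by rewrite rpredD // rpredZ.
Qed.

Definition preim_submod (N : submod X) : submod M := Submod (preim_closed N).

Lemma mem_preim_submod N x : (x \in preim_submod N) = (f x \in N).
Proof. by []. Qed.

Fact im_closed (N : submod M) :
  submod_closed [pred y : X | `[< exists2 x, x \in N & y = f x >]].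
Proof.
split=> [|a _ _ /asboolP[x xN ->] /asboolP[y yN ->]]; apply/asboolP.
  by exists 0; rewrite ?linear0 ?rpred0.
by exists (a *: x + y); rewrite ?linearP // rpredD // rpredZ.
Qed.

Definition im_submod (N : submod M) : submod X := Submod (im_closed N).

Fact ker_closed : submod_closed [pred x : M | f x == 0].
Proof.
split=> [|a x y]; rewrite !inE ?linear0 // linearP => /eqP-> /eqP->.
by rewrite scaler0 addr0.
Qed.

Definition ker_submod : submod M := Submod ker_closed.

End Images.

Fact full_closed (M : lmodType R) : submod_closed [pred x : M | true].
Proof. by []. Qed.
Definition full_submod (M : lmodType R) : submod M := Submod (@full_closed M).

Fact zero_closed (M : lmodType R) : submod_closed [pred x : M | x == 0].
Proof.
by split=> [|a x y]; rewrite !inE // => /eqP-> /eqP->; rewrite scaler0 addr0.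
Qed.
Definition zero_submod (M : lmodType R) : submod M := Submod (@zero_closed M).

Section Quotients.
Variables (M : lmodType R) (N : submod M).

Definition quot_pi (x : M) : quot_mod N := \pi_(quot_mod N) x.

Fact quot_pi_linear : linear quot_pi.
Proof. by move=> a x y; rewrite /quot_pi raddfD /=; congr (_ + _);
  rewrite -quot_scaleE. Qed.

HB.instance Definition _ :=
  GRing.isLinear.Build R M (quot_mod N) *:%R quot_pi quot_pi_linear.

Lemma quot_pi_surj y : exists x, y = quot_pi x.
Proof. by exists (repr y); rewrite /quot_pi reprK. Qed.

Lemma quot_pi_eq0 x : (quot_pi x == 0) = (x \in N).
Proof.
rewrite -(linear0 quot_pi).
by apply/eqP/idP => [/pi_eqP|xN]; [|apply/pi_eqP]; rewrite subr0.
Qed.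

Lemma simple_quotP : simple_mod (quot_mod N) <-> maximal_submod N.
Proof.
split=> [[[y y0] simpM]|[[x xN] maxN]].
  split.
    by have [x yx] := quot_pi_surj y; exists x; rewrite -quot_pi_eq0 -yx;
      apply/eqP.
  move=> N' NN'; have [im0|imT] := simpM (im_submod quot_pi N').
    by left=> x xN'; rewrite -quot_pi_eq0; apply/eqP/im0/asboolP; exists x.
  right=> x; have /asboolP[x' x'N' /eqP] := imT (quot_pi x).
  rewrite -subr_eq0 -linearB quot_pi_eq0 => /NN' xx'N'.
  by rewrite -(subrK x' x) rpredD.
split; first by exists (quot_pi x); apply/eqP; rewrite quot_pi_eq0.
move=> N'; have [|sub|full] := maxN (preim_submod quot_pi N').
- move=> z; rewrite -quot_pi_eq0 mem_preim_submod /= => /eqP->; exact: rpred0.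
- left=> y; have [z ->] := quot_pi_surj y; move=> zN'.
  by apply/eqP; rewrite quot_pi_eq0 sub.
by right=> y; have [z ->] := quot_pi_surj y; have := full z.
Qed.

End Quotients.

Lemma iso_mod_sym (M X : lmodType R) : iso_mod M X -> iso_mod X M.
Proof.
move=> [f [g fK gK]].
pose gL := GRing.isLinear.Build R X M *:%R g (can2_linear fK gK).
pose g' : {linear X -> M} := HB.pack g gL.
by exists g'; exists f.
Qed.

Lemma iso_mod_trans (M X Y : lmodType R) :
  iso_mod M X -> iso_mod X Y -> iso_mod M Y.
Proof.
by move=> [f fb] [g gb]; exists (g \o f : {linear M -> Y}); apply: bij_comp.
Qed.

Lemma quot_iso (M X : lmodType R) (f : {linear M -> X}) (N : submod M) :
  (forall y, exists x, y = f x) -> (forall x, (x \in N) = (f x == 0)) ->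
  iso_mod (quot_mod N) X.
Proof.
move=> fsurj kerf; pose h (y : quot_mod N) := f (repr y).
have h_pi x : h (quot_pi N x) = f x.
  apply/eqP; rewrite -subr_eq0 -linearB -kerf -quot_pi_eq0 linearB /=.
  by rewrite {1}/quot_pi reprK subrr.
have h_lin : linear h.
  move=> a y z; have [[x ->] [w ->]] := (quot_pi_surj y, quot_pi_surj z).
  by rewrite -linearP !h_pi linearP.
pose hL := GRing.isLinear.Build R (quot_mod N) X *:%R h h_lin.
pose h' : {linear quot_mod N -> X} := HB.pack h hL.
exists h'; have [g gK] := choice fsurj; exists (fun y => quot_pi N (g y)).
  move=> y; have [x ->] := quot_pi_surj y; rewrite /= h_pi.
  by apply/eqP; rewrite -subr_eq0 -linearB quot_pi_eq0 kerf linearB /= -gK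
    subrr.
by move=> y; rewrite /= h_pi -gK.
Qed.

Section Subquotients.
Variables (M : lmodType R) (U V : submod M).
Implicit Type W : submod M.

(** Submodules of [subquot U V] correspond to those of [M] between [V] and [U], so series can be
    handled inside [M]. *)
Lemma simple_subquotP : {subset V <= U} -> simple_mod (subquot U V) <->
  (exists2 x, x \in U & x \notin V) /\
  forall W, {subset V <= W} -> {subset W <= U} ->
    {subset W <= V} \/ {subset U <= W}.
Proof.
move=> VU; rewrite /subquot simple_quotP;
  split=> [[[x xV] maxV]|[[x xU xnV] maxV]].
  split; first by exists (val x) => //; apply: valP.
  move=> W VW WU.
  have [y|WV|UW] := maxV (preim_submod (\val : sub_mod U -> M) W).
  - by move=> /VW.
  - by left=> y yW; apply: (WV (SubMod (WU _ yW))).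
  by right=> y yU; apply: (UW (SubMod yU)).
split; first by exists (SubMod xU).
move=> W VW; pose W' := im_submod (\val : sub_mod U -> M) W.
have memW' (y : sub_mod U) : (val y \in W') = (y \in W).
  by apply/asboolP/idP => [[z zW /val_inj->]|yW] //; exists y.
have WU y : y \in W' -> y \in U by case/asboolP => z _ ->; apply: valP.
have [y yV||W'V|UW'] := maxV W'.
- by rewrite -[y]/(val (SubMod (VU _ yV))) memW' VW.
- exact: WU.
- by left=> y; rewrite -memW' => /W'V.
by right=> y; rewrite -memW' UW' ?(valP y).
Qed.

Lemma subquot_actP a :
  (exists x : subquot U V, a *: x <> 0) <->
  (exists2 x, x \in U & a *: x \notin V).
Proof.
split=> [[x]|[x xU axV]].
  have [[y yU] ->] := quot_pi_surj x; rewrite -linearZ => /eqP.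
  by rewrite quot_pi_eq0 => ayV; exists y.
exists (quot_pi _ (SubMod xU)); rewrite -linearZ; apply/eqP.
by rewrite quot_pi_eq0.
Qed.

End Subquotients.


Lemma simple_subquot_full (M : lmodType R) (U V : submod M) :
  (forall x, x \in U) -> (forall x, x \in V -> x = 0) ->
  simple_mod (subquot U V) <-> simple_mod M.
Proof.
move=> UT V0; rewrite simple_subquotP => [|x _]; last exact: UT.
split=> -[[x]].
  move=> _ xV maxV; split; first by exists x => x0; rewrite x0 rpred0 in xV.
  move=> W; have [||WV|UW] := maxV W.
  - by move=> y /V0->; apply: rpred0.
  - by move=> y _; apply: UT.
  - by left=> y /WV/V0.
  by right=> y; apply: UW.
move=> x0 simpM; split; first by exists x; [|apply/negP => /V0].
move=> W _ _; have [W0|WT] := simpM W; last by right=> y _.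
by left=> y /W0->; apply: rpred0.
Qed.

(** Ending at [U] instead of the whole module allows induction on [U] inside a fixed [M]. *)
Definition series_to (M : lmodType R) (U : submod M) l (N : nat -> submod M) :=
  [/\ forall x, x \in N 0 -> x = 0, N l =i U &
      forall t, (t < l)%N ->
        {subset N t <= N t.+1} /\ simple_mod (subquot (N t.+1) (N t))].

Lemma comp_seriesE (M : lmodType R) l (N : nat -> submod M) :
  comp_series l N <-> series_to (full_submod M) l N.
Proof.
by split=> -[N0 NT step]; split=> // x; rewrite NT.
Qed.

Lemma series_to_mono (M : lmodType R) (U : submod M) l N : series_to U l N ->
  forall s t, (s <= t <= l)%N -> {subset N s <= N t}.
Proof.
move=> [_ _ step] s t /andP[]; elim: t => [|t IH];
  first by rewrite leqn0 => /eqP-> _ x.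
rewrite leq_eqVlt => /predU1P[-> _ //|st] tl x xs.
by have [sub _] := step _ tl; apply/sub/IH => //; apply: ltnW.
Qed.

Lemma simple_subquot_ext (M : lmodType R) (U U' V V' : submod M) :
  U =i U' -> V =i V' -> {subset V <= U} ->
  simple_mod (subquot U V) -> simple_mod (subquot U' V').
Proof.
move=> eqU eqV VU /(simple_subquotP VU)[[x xU xV] maxV].
apply/simple_subquotP; first by move=> y; rewrite -eqU -eqV; apply: VU.
split; first by exists x; rewrite -?eqU -?eqV.
move=> W VW WU; have [y|y|WV|UW] := maxV W.
- by rewrite eqV; apply: VW.
- by rewrite eqU; apply: WU.
- by left=> y; rewrite -eqV; apply: WV.
by right=> y; rewrite -eqU; apply: UW.
Qed.

Lemma series_to_rcons (M : lmodType R) (U V : submod M) l N :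
  series_to V l N -> {subset V <= U} -> simple_mod (subquot U V) ->
  series_to U l.+1 (fun t => if (t <= l)%N then N t else U).
Proof.
move=> [N0 Nl step] VU simpU; split=> //=.
  by move=> x; rewrite ltnn.
move=> t; rewrite ltnS leq_eqVlt => /predU1P[->|tl].
  rewrite eqxx ltnn /=; split; first by move=> x; rewrite Nl => /VU.
  by apply: simple_subquot_ext simpU => // x; rewrite Nl.
by rewrite tl orbT; apply: step.
Qed.

(** A numerical form of finite length: strict monotonicity bounds the chains below each
    submodule. *)
Definition ranked (M : lmodType R) := exists d : submod M -> nat,
  forall U V : submod M, {subset U <= V} -> ~ {subset V <= U} -> (d U < d V)%N.

Lemma not_subsetP (T : Type) (P Q : {pred T}) :
  ~ {subset P <= Q} -> exists2 x, x \in P & x \notin Q.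
Proof.
move=> nPQ; apply: contrapT => nx; apply: nPQ => x xP.
by apply: contrapT => /negP xQ; apply: nx; exists x.
Qed.

(** Induction on the rank of [U]: a proper submodule of greatest rank is maximal in [U], and its
    series is extended by one step. *)
Lemma ranked_series (M : lmodType R) (U : submod M) :
  ranked M -> exists l N, series_to U l N.
Proof.
move=> [d d_mono]; have [m] := ubnP (d U); elim: m U => // m IH U dU.
have [[V [VU nUV maxV]]|nV] := pselect (exists V : submod M,
    [/\ {subset V <= U}, ~ {subset U <= V} & forall W : submod M,
       {subset W <= U} -> ~ {subset U <= W} -> (d W <= d V)%N]); last first.
  (* Without such a [V], [U] is zero: a nonzero [x] makes [zero_submod] proper in [U], and the
     bounded ranks of proper submodules then attain a maximum. *)
  exists 0, (fun=> U); split=> // x xU; apply: contrapT => x0; apply: nV.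
  pose P m := `[< exists W : submod M,
    [/\ {subset W <= U}, ~ {subset U <= W} & d W = m] >].
  have exP : exists m, P m.
    exists (d (zero_submod M)); apply/asboolP; exists (zero_submod M).
    by split=> [y /eqP->|/(_ _ xU)/eqP//|//]; apply: rpred0.
  have leP s : P s -> (s <= m)%N.
    by case/asboolP=> W [WU nUW <-];
      rewrite -ltnS (leq_trans _ dU) // ltnS ltnW ?d_mono.
  case: (ex_maxnP exP leP) => s /asboolP[V [VU nUV <-]] maxs.
  exists V; split=> // W WU nUW; apply: maxs.
  by apply/asboolP; exists W.
have [|l [N serN]] := IH V;
  first by rewrite -ltnS (leq_trans _ dU) // ltnS d_mono.
exists l.+1, (fun t => if (t <= l)%N then N t else U).
apply: series_to_rcons serN _ _ => //; apply/simple_subquotP => //; split.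
  exact: not_subsetP.
move=> W VW WU; have [UW|nUW] := pselect {subset U <= W}; [by right|left].
apply: contrapT => nWV; have := maxV W WU nUW.
by rewrite leqNgt d_mono.
Qed.

End Modules.

(** * Primitive idempotents: Fitting's lemma and locality of [e A e] *)

Section PrimitiveIdempotent.
Variables (k : fieldType) (A : falgType k).
Implicit Types (e x y z : A).

(** The dimensions are bounded by that of [A]. The exponent is a successor so that a factor [x] can
    later be split off. *)
Lemma lker_amulr_max x : exists m, forall s,
  (\dim (lker (amulr (x ^+ s))) <= \dim (lker (amulr (x ^+ m.+1))))%N.
Proof.
pose P d := `[< exists m, d = \dim (lker (amulr (x ^+ m.+1))) >].
have exP : exists d, P d by exists (\dim (lker (amulr (x ^+ 1))));
  apply/asboolP; exists 0%N.
have leP d : P d -> (d <= \dim {:A})%N by case/asboolP=> m ->;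
  rewrite dimvS ?subvf.
case: (ex_maxnP exP leP) => _ /asboolP[m ->] maxm; exists m => s.
apply: leq_trans (maxm (\dim (lker (amulr (x ^+ s.+1)))) _);
  last by apply/asboolP; exists s.
apply/dimvS/subvP => z; rewrite !memv_ker !lfunE /= => /eqP zx.
by rewrite exprSr mulrA zx mul0r.
Qed.

(* Fitting's lemma for right multiplication by [x] on [A]. *)
Lemma fitting_decomposition x : exists m (b : A),
  x ^+ m.+1 = b * x ^+ m.+1 * x ^+ m.+1 /\
  forall c, c * x ^+ m.+1 * x ^+ m.+1 = 0 -> c * x ^+ m.+1 = 0.
Proof.
have [m maxm] := lker_amulr_max x; set v := x ^+ m.+1 in maxm *.
have vvE : v * v = x ^+ (m.+1 + m.+1) by rewrite exprD.
have kerS : (lker (amulr v) <= lker (amulr (v * v)%R))%VS.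
  apply/subvP => z; rewrite !memv_ker !lfunE /= mulrA => /eqP->.
  by rewrite mul0r.
(* By maximality [v] and [v * v] have the same kernel, hence by rank-nullity the same image, and
   that image contains [v]. *)
have kerE : lker (amulr v) = lker (amulr (v * v)%R).
  by apply/eqP; rewrite eqEdim kerS vvE maxm.
have imgS : (limg (amulr (v * v)%R) <= limg (amulr v))%VS.
  apply/subvP => _ /memv_imgP[z _ ->]; rewrite lfunE /= mulrA.
  by apply/memv_imgP; exists (z * v); rewrite ?memvf // lfunE.
have imgE : limg (amulr (v * v)%R) = limg (amulr v).
  apply/eqP; rewrite eqEdim imgS /=.
  have := limg_ker_dim (amulr (v * v)%R) fullv; rewrite -kerE.
  by rewrite -(limg_ker_dim (amulr v) fullv) => /addnI->.
have : v \in limg (amulr (v * v)%R).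
  by rewrite imgE; apply/memv_imgP; exists 1; rewrite ?memvf // lfunE /= mul1r.
case/memv_imgP=> b _; rewrite lfunE /= => vb; exists m, b.
rewrite -/v -mulrA; split=> // c cvv.
have : c \in lker (amulr (v * v)%R) by rewrite memv_ker lfunE /= mulrA cvv.
by rewrite -kerE memv_ker lfunE /= => /eqP.
Qed.

Variable e : A.
Hypothesis e_prim : primitive_idempotent e.

Let ee : e * e = e. Proof. by case: e_prim. Qed.

Lemma primitive_idem f : e * f * e = f -> f * f = f -> f = 0 \/ f = e.
Proof.
move=> fe ff; have [_ _ /(_ f (e - f)) e_fg] := e_prim.
have ef : e * f = f by rewrite -{1}fe !mulrA ee.
have fe' : f * e = f by rewrite -{1}fe -!mulrA ee mulrA fe.
have ff' : f * (e - f) = 0 by rewrite mulrBr ff fe' subrr.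
have f'f : (e - f) * f = 0 by rewrite mulrBl ff ef subrr.
have f'f' : (e - f) * (e - f) = e - f by rewrite mulrBl ff' subr0 mulrBr ee ef.
have [|f0|/eqP] := e_fg ff f'f' ff' f'f; [by rewrite addrC subrK|by left|].
by rewrite subr_eq0 => /eqP; right.
Qed.

(** Fitting's lemma makes [e * b * x ^+ m.+1] an idempotent of [e A e]. If it is [0] then [x] is
    nilpotent; if it is [e] then [x] has a left inverse. *)
Lemma primitive_unit_or_nil x : e * x * e = x ->
  (exists y, y * x = e) \/ exists m, x ^+ m = 0.
Proof.
move=> xe; have [m [b []]] := fitting_decomposition x.
have: e * x ^+ m.+1 * e = x ^+ m.+1.
  have ex : e * x = x by rewrite -{1}xe !mulrA ee.
  have xe' : x * e = x by rewrite -{1}xe -!mulrA ee mulrA xe.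
  by rewrite exprS mulrA ex -exprS exprSr -mulrA xe'.
set v := x ^+ m.+1 => eve vb vinj.
have ev : e * v = v by rewrite -{1}eve !mulrA ee.
have ve : v * e = v by rewrite -{1}eve -!mulrA ee mulrA eve.
have fv : e * b * v * v = v by rewrite -!mulrA (mulrA b) -vb.
have [|||fe] := @primitive_idem (e * b * v).
- by rewrite -!mulrA ve !mulrA ee.
(* Right multiplication by [v] is injective on [A v], so idempotency may be tested after multiplying
   by [v], where [fv] applies. *)
- apply/eqP; rewrite -subr_eq0 mulrA -mulrBl; apply/eqP/vinj.
  by rewrite !mulrBl fv -!(mulrA (e * b * v)) fv fv subrr.
- by move=> f0; right; exists m.+1; rewrite -/v -fv f0 mul0r.
by left; exists (e * b * x ^+ m); rewrite -mulrA -exprSr.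
Qed.

(** If [x] is nilpotent, the geometric series inverts [e - x]. *)
Lemma primitive_local x : e * x * e = x ->
  (exists y, y * x = e) \/ (exists y, y * (e - x) = e).
Proof.
move=> xe; have [|[m xm]] := primitive_unit_or_nil xe; [by left|right].
have xe' : x * e = x by rewrite -{1}xe -!mulrA ee mulrA xe.
exists (e * \sum_(t < m) x ^+ t).
have -> : e - x = (1 - x) * e by rewrite mulrBl mul1r xe'.
have -> : e * (\sum_(t < m) x ^+ t) * ((1 - x) * e) =
  e * ((\sum_(t < m) x ^+ t) * (1 - x)) * e by rewrite !mulrA.
suff -> : (\sum_(t < m) x ^+ t) * (1 - x) = 1 by rewrite mulr1 ee.
have c : GRing.comm (\sum_(t < m) x ^+ t) (1 - x).
  apply: commrB; first exact: commr1.
  by apply: commr_sym; apply: commr_sum => t _; apply: commrX.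
rewrite c; apply: oppr_inj; rewrite -mulNr opprB -subrX1 xm sub0r //.
Qed.

(** [x * y] is idempotent, and nonzero because [e = y * (x * y) * x]. *)
Lemma primitive_left_inv_right x y : e * x * e = x -> e * y * e = y ->
  y * x = e -> x * y = e.
Proof.
move=> xe ye yx.
have xe' : x * e = x by rewrite -{1}xe -!mulrA ee mulrA xe.
have ex : e * x = x by rewrite -{1}xe !mulrA ee.
have ye' : y * e = y by rewrite -{1}ye -!mulrA ee mulrA ye.
have [|||//] := @primitive_idem (x * y).
- by rewrite !mulrA ex -mulrA ye'.
- by rewrite mulrA -(mulrA x) yx xe'.
move=> xy0; case: e_prim => _ []; rewrite -ee -{1}yx -mulrA -[e]yx.
by rewrite [x * _]mulrA xy0 mul0r mulr0.
Qed.

End PrimitiveIdempotent.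

(** * The projective module [A e], its radical and its top *)

Section ProjectiveModules.
Variables (k : fieldType) (A : falgType k) (e : A).
Implicit Types (z w : Pmod e) (N : submod (Pmod e)).

Definition pval z : A := sub_val z.

Lemma pval_inj : injective pval. Proof. exact: val_inj. Qed.

Lemma pvalZ a z : pval (a *: z) = a * pval z. Proof. by []. Qed.

Lemma pvalD z w : pval (z + w) = pval z + pval w. Proof. by []. Qed.

Fact pelem_subproof a : a * e \in Submod (lideal_closed e).
Proof. by apply/asboolP; exists a. Qed.

Definition pelem a : Pmod e := SubMod (pelem_subproof a).

Lemma pvalK z : pelem (pval z) = pval z *: pelem 1.
Proof. by apply: pval_inj; rewrite pvalZ /pval /= mul1r. Qed.

Hypothesis e_prim : primitive_idempotent e.

Let ee : e * e = e. Proof. by case: e_prim. Qed.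
Let e0 : e <> 0. Proof. by case: e_prim. Qed.

Lemma pval_idem z : pval z * e = pval z.
Proof.
by case: z => x xP; rewrite /pval /=; have /asboolP[a ->] := xP;
  rewrite -mulrA ee.
Qed.

Lemma pelem_pval z : pelem (pval z) = z.
Proof. by apply: pval_inj; rewrite -[RHS]pval_idem. Qed.

(** These are the elements that do not generate [A e]; their closure under addition rests on the
    locality of [e A e]. *)
Fact prad_closed :
  submod_closed [pred z : Pmod e | `[< forall b, b * pval z <> e >]].
Proof.
split=> [|a z w /asboolP zJ /asboolP wJ]; apply/asboolP => b.
  by rewrite /pval /= mulr0 => /esym.
rewrite pvalD pvalZ mulrDr => be.
(* [e] is the sum of [e * (b * (a * pval z))] and [e * (b * pval w)]; a left inverse of either
   contradicts [zJ] or [wJ]. *)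
have [|[y]|[y]] := primitive_local e_prim (x := e * (b * (a * pval z))).
- by rewrite mulrA ee -!mulrA pval_idem.
- by rewrite !mulrA; apply: zJ.
have -> : e - e * (b * (a * pval z)) = e * (b * pval w).
  by rewrite -{1}ee -{2}be mulrDr addrAC subrr add0r.
by rewrite !mulrA; apply: wJ.
Qed.

Definition prad : submod (Pmod e) := Submod prad_closed.

Lemma mem_prad z : z \in prad <-> forall b, b * pval z <> e.
Proof. by split=> /asboolP. Qed.

Lemma pelem1_idem : e *: pelem 1 = pelem 1.
Proof. by apply: pval_inj; rewrite pvalZ /pval /= mul1r ee. Qed.

Lemma pelem1_notin_prad : pelem 1 \notin prad.
Proof. by apply/negP => /mem_prad/(_ 1); rewrite /pval /= !mul1r. Qed.

Lemma proper_sub_prad N : (exists z, z \notin N) -> {subset N <= prad}.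
Proof.
move=> [w wN] z zN; apply/mem_prad => b bz; case/negP: wN.
rewrite -[w]pelem_pval pvalK rpredZ //.
suff -> : pelem 1 = b *: z by apply: rpredZ.
by apply: pval_inj; rewrite pvalZ bz /pval /= mul1r.
Qed.

Lemma prad_maximal : maximal_submod prad.
Proof.
split; first by exists (pelem 1); apply: pelem1_notin_prad.
move=> N _; have [NT|nN] := pselect (forall z, z \in N); first by right.
left; apply: proper_sub_prad; apply: contrapT => nz; apply: nN => z.
by apply: contrapT => /negP zN; apply: nz; exists z.
Qed.

Lemma maximal_prad N : maximal_submod N <-> N =i prad.
Proof.
split=> [[properN maxN]|eqN].
  have Nrad := proper_sub_prad properN.
  have [radN|radT] := maxN prad Nrad; last first.
    by have := pelem1_notin_prad; rewrite radT.
  by move=> z; apply/idP/idP; [apply: Nrad|apply: radN].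
have [[z zN] maxrad] := prad_maximal.
split; first by exists z; rewrite eqN.
move=> N' NN'; have [z' z'J|N'N|N'T] := maxrad N'; last by right.
  by apply: NN'; rewrite eqN.
by left=> z' /N'N; rewrite eqN.
Qed.

Lemma cap_maximal : cap_submod (@maximal_submod _ (Pmod e)) =i prad.
Proof.
apply: cap_submod_least; first exact: prad_maximal.
by move=> N /maximal_prad eqN z; rewrite eqN.
Qed.

(** The map from [Pmod e] sending [pelem 1] to [e *: x] is onto by simplicity, and its kernel is
    maximal, hence equal to [prad]. *)
Lemma simple_iso_Smod (X : lmodType A) (x : X) :
  simple_mod X -> e *: x <> 0 -> iso_mod X (Smod e).
Proof.
move=> [_ simpX] ex.
have f_lin : linear (fun z : Pmod e => pval z *: x).
  by move=> a z w; rewrite pvalD pvalZ scalerDl scalerA.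
pose fL := GRing.isLinear.Build A (Pmod e) X *:%R _ f_lin.
pose f : {linear Pmod e -> X} := HB.pack (fun z : Pmod e => pval z *: x) fL.
have f1 : f (pelem 1) = e *: x by rewrite /= /pval /= mul1r.
have fsurj y : exists z, y = f z.
  have [im0|imT] := simpX (im_submod f (full_submod _)); last first.
    by have /asboolP[z _ ->] := imT y; exists z.
  by case: ex; rewrite -f1; apply: im0; apply/asboolP; exists (pelem 1).
have /maximal_prad kerE : maximal_submod (ker_submod f).
  split; first by exists (pelem 1); apply/negP => /eqP; rewrite f1.
  move=> N kerN; have [im0|imT] := simpX (im_submod f N).
    by left=> z zN; apply/eqP/im0/asboolP; exists z.
  right=> z; have /asboolP[w wN /eqP] := imT (f z).
  by rewrite -subr_eq0 -linearB => /kerN zwN; rewrite -(subrK w z) rpredD.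
apply/iso_mod_sym/(quot_iso fsurj) => z.
by rewrite cap_maximal -kerE.
Qed.

Lemma top_idem : exists x : Smod e, e *: x <> 0.
Proof.
exists (quot_pi _ (pelem 1)); rewrite -linearZ; apply/eqP; rewrite quot_pi_eq0.
by rewrite cap_maximal pelem1_idem pelem1_notin_prad.
Qed.

End ProjectiveModules.

(** * Finite length of cyclic modules *)

Section CyclicModules.
Variables (k : fieldType) (A : falgType k) (M : lmodType A) (g : M).

(* The rank of [U] is the [k]-dimension of the left ideal [{a | a g \in U}],
   obtained as the largest dimension of a subspace contained in it. *)
Lemma cyclic_ranked : (forall x, exists a, x = a *: g) -> ranked M.
Proof.
move=> gen; pose P (U : submod M) (m : nat) :=
  `[< exists2 V : {vspace A}, \dim V = m & forall a, a \in V -> a *: g \in U >].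
pose d U := (\max_(m < (\dim {:A}).+1 | P U m) m)%N.
exists d => U V UV nVU.
have [x xV xU] := not_subsetP nVU.
have P0 : P U 0%N.
  apply/asboolP; exists 0%VS; rewrite ?dimv0 // => a.
  by rewrite memv0 => /eqP->; rewrite scale0r rpred0.
have [] := @eq_bigmax_cond _ [pred m :
  'I_(\dim {:A}).+1 | P U m] (fun m => m : nat).
  by apply/card_gt0P; exists ord0.
move=> m /asboolP[W dimW WU] dUm.
rewrite [d U]dUm -dimW; have [a xa] := gen x; rewrite {}xa in xV xU.
have aW : a \notin W by apply: contra xU => /WU.
(* Since [a *: g] lies in [V] but not in [U], adding the line of [a] to [W] gains one dimension
   inside the left ideal attached to [V]. *)
have dimWa : \dim (W + <[a]>)%VS = (\dim W).+1.
  rewrite dimv_disjoint_sum ?dim_vline; last first.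
    apply/eqP; rewrite -subv0; apply/subvP => y;
      rewrite memv_cap => /andP[yW /vlineP[c yc]].
    rewrite memv0 yc in yW *; have [->|c0] := eqVneq c 0;
      first by rewrite scale0r.
    by case/negP: aW; rewrite -[a](scalerK c0) memvZ.
  by case: eqP aW => [->|_ _]; rewrite ?mem0v // addn1.
rewrite -dimWa; have lt_dim :
  (\dim (W + <[a]>)%VS < (\dim {:A}).+1)%N by rewrite ltnS dimvS ?subvf.
apply: (leq_bigmax_cond (Ordinal lt_dim)).
apply/asboolP; exists (W + <[a]>)%VS =>
  // _ /memv_addP[b bW [_ /vlineP[c ->] ->]].
rewrite scalerDl rpredD //; first by apply/UV/WU.
by rewrite -[a in c *: a]mul1r scalerAl -scalerA rpredZ.
Qed.

End CyclicModules.

(** * Nakayama's lemma over the local ring [e A e] *)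

Section Nakayama.
Variables (k : fieldType) (A : falgType k) (e : A).
Hypothesis e_prim : primitive_idempotent e.

Let ee : e * e = e. Proof. by case: e_prim. Qed.

(* For a primitive idempotent [e] this is the Jacobson radical of the local
   ring [e A e]. *)
Definition corner_rad (c : A) := e * c * e = c /\ forall b, b * c <> e.

Lemma corner_rad0 : corner_rad 0.
Proof.
by split=> [|b]; rewrite ?mulr0 ?mul0r // => /esym; case: e_prim.
Qed.

Lemma corner_radD c d : corner_rad c -> corner_rad d -> corner_rad (c + d).
Proof.
move=> [ce cJ] [de dJ]; split; first by rewrite mulrDr mulrDl ce de.
have pvalE x : e * x * e = x -> pval (pelem e x) = x.
  by move=> xe; rewrite /pval /= -xe -!mulrA ee.
have : pelem e c + pelem e d \in prad e_prim.
  by rewrite rpredD //; apply/mem_prad; rewrite pvalE.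
by move=> /mem_prad; rewrite pvalD !pvalE.
Qed.

(** A left inverse of the product makes [e * u * e] invertible on both sides; moving this factor to
    the left end yields a left inverse of [c]. *)
Lemma corner_radM c u : corner_rad c -> corner_rad (c * (e * u * e)).
Proof.
move=> [ce cJ]; have ec : e * c = c by rewrite -ce !mulrA ee.
split; first by rewrite !mulrA ec -!mulrA ee.
move=> b bcu; have ce' : c * e = c by rewrite -ce -!mulrA ee.
have yx : e * b * c * (e * u * e) = e by rewrite -(mulrA (e * b)) -(mulrA e)
  bcu ee.
apply: (cJ (e * u * e * (e * b))); rewrite -mulrA.
apply: primitive_left_inv_right yx => //; first by rewrite !mulrA ee -mulrA ee.
by rewrite !mulrA ee -mulrA ce'.
Qed.

(** Membership in the sum of the [w * J] for [w] in [s], with [J] the radical of [e A e]. The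
    recursion exposes the coefficient of the first generator, ready for elimination. *)
Fixpoint rad_comb (s : seq A) (x : A) : Prop :=
  if s is w :: s' then exists2 c, corner_rad c & rad_comb s' (x - w * c)
  else x = 0.

Lemma rad_comb0 s : rad_comb s 0.
Proof.
elim: s => //= w s IH; exists 0; first exact: corner_rad0.
by rewrite mulr0 subrr.
Qed.

Lemma rad_combD s x y : rad_comb s x -> rad_comb s y -> rad_comb s (x + y).
Proof.
elim: s x y => /= [x y -> ->|w s IH x y [c cJ xc] [d dJ yd]].
  by rewrite addr0.
by exists (c + d); [apply: corner_radD|rewrite mulrDr opprD addrACA; apply: IH].
Qed.

Lemma rad_combM s x u : rad_comb s x -> rad_comb s (x * (e * u * e)).
Proof.
elim: s x => /= [x ->|w s IH x [c cJ xc]]; first by rewrite mul0r.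
exists (c * (e * u * e)); first exact: corner_radM.
by rewrite (mulrA w) -mulrBl; apply: IH.
Qed.

Lemma rad_comb_span s w c : w \in <<s>>%VS -> corner_rad c ->
  rad_comb s (w * c).
Proof.
move=> + cJ; elim: s w => [w|v s IH w] /=.
  by rewrite span_nil memv0 => /eqP->; rewrite mul0r.
rewrite span_cons => /memv_addP[_ /vlineP[a ->] [w' w's ->]].
exists (a *: c).
  have [ce _] := cJ;
    suff -> : a *: c = c * (e * a%:A * e) by apply: corner_radM.
  have ce' : c * e = c by rewrite -ce -!mulrA ee.
  by rewrite -[e * a%:A]scalerAr mulr1 -scalerAl ee -scalerAr ce'.
by rewrite mulrDl -scalerAl -scalerAr addrAC subrr add0r; apply: IH.
Qed.

(* Nakayama's lemma, eliminating the generators one at a time. *)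
Lemma rad_comb_nakayama s : (forall w, w \in s -> w * e = w) ->
  (forall w, w \in s -> rad_comb s w) -> forall w, w \in s -> w = 0.
Proof.
elim: s => // w s IH se gen.
have we : w * e = w by rewrite se ?mem_head.
(* [w * (e - c)] is a combination of [s] alone, and [e - c] is invertible in [e A e] because [c]
   lies in the radical. *)
have ws : rad_comb s w.
  have [c [ce cJ] wc] := gen w (mem_head _ _).
  have [[b /cJ//]|[y ye]] := primitive_local e_prim ce.
  have ec : e * (e - c) = e - c by rewrite mulrBr ee -ce !mulrA ee.
  have ce' : (e - c) * e = e - c by rewrite mulrBl ee -ce -!mulrA ee.
  have inv : (e - c) * (e * y * e) = e.
    apply: (primitive_left_inv_right e_prim); first by rewrite ec ce'.
      by rewrite !mulrA ee -mulrA ee.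
    by rewrite -mulrA ec -mulrA ye.
  suff -> : w = (w - w * c) * (e * y * e) by apply: rad_combM.
  by rewrite -{2}we -mulrBr -(mulrA w) inv we.
have gens v : v \in s -> rad_comb s v.
  move=> vs; have [|c [ce _] vc] := gen v; first by rewrite in_cons vs orbT.
  by rewrite -[v](subrK (w * c)); apply: rad_combD => //; rewrite -ce;
    apply: rad_combM.
have s0 : forall v, v \in s -> v = 0.
  by apply: IH => // v vs; apply: se; rewrite in_cons vs orbT.
move=> v; rewrite in_cons => /predU1P[->|/s0//].
(* The remaining generators all vanish, so the combination [w] of them does too. *)
elim: s s0 w ws {IH se gen gens we} => //= a s IH s0 w [c _].
have -> : a = 0 by apply: s0; apply: mem_head.
rewrite mul0r subr0; apply: IH => b bs.
by apply: s0; rewrite in_cons bs orbT.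
Qed.

End Nakayama.

(** * Composition factors detected by idempotents *)

Section CompositionFactors.
Variables (k : fieldType) (A : falgType k).

Lemma iso_mod_act (X Y : lmodType A) (a : A) :
  iso_mod X Y -> (exists x : X, a *: x <> 0) -> exists y : Y, a *: y <> 0.
Proof.
move=> [f /bij_inj f_inj] [x ax]; exists (f x).
by rewrite -linearZ -[0](linear0 f) => /f_inj.
Qed.

(** Among simple modules, [f] acts nontrivially exactly on the copies of [Smod f]; its action on [M]
    is traced along a composition series. *)
Lemma comp_factor_idemP (M : lmodType A) (f : A) : primitive_idempotent f ->
  ranked M -> comp_factor M (Smod f) <-> exists x : M, f *: x <> 0.
Proof.
move=> f_prim rM; have [ff _ _] := f_prim; split.
  move=> [l [N [_ [t tl /iso_mod_sym isoN]]]].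
  have [x _ xN] := (subquot_actP _ _ _).1 (iso_mod_act isoN (top_idem f_prim)).
  by exists x => fx; rewrite fx rpred0 in xN.
move=> [x fx]; have [l [N serN]] := ranked_series (full_submod M) rM.
exists l, N; split; first exact/comp_seriesE.
have [N0 NT step] := serN.
have exN : exists t, f *: x \in N t by exists l; rewrite NT.
(* The first term containing [f *: x] is not [N 0], so [f *: x] survives modulo the term before
   it. *)
case: (ex_minnP exN) => -[/N0//|t] xt mint;
  have tl : (t < l)%N by apply: mint; rewrite NT.
exists t => //; have [_ simpN] := step _ tl.
have : exists y : subquot (N t.+1) (N t), f *: y <> 0.
  apply/subquot_actP; exists (f *: x) => //; rewrite scalerA ff.
  by apply/negP => /mint; rewrite ltnn.
by case=> y; apply: simple_iso_Smod.
Qed.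

Lemma quot_ranked (f : A) (N : submod (Pmod f)) :
  primitive_idempotent f -> ranked (quot_mod N).
Proof.
move=> f_prim; apply: (cyclic_ranked (g := quot_pi N (pelem f 1))) => y.
have [z ->] := quot_pi_surj y; exists (pval z).
by rewrite -linearZ -pvalK pelem_pval.
Qed.

Lemma quot_actP (M : lmodType A) (N : submod M) a :
  (exists x : quot_mod N, a *: x <> 0) <-> exists z, a *: z \notin N.
Proof.
split=> [[x]|[z az]].
  have [z ->] := quot_pi_surj x; rewrite -linearZ => /eqP.
  by rewrite quot_pi_eq0 => az; exists z.
by exists (quot_pi N z); rewrite -linearZ; apply/eqP; rewrite quot_pi_eq0.
Qed.

Lemma comp_factor_quotP (e f : A) (N : submod (Pmod e)) :
  primitive_idempotent e -> primitive_idempotent f ->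
  comp_factor (quot_mod N) (Smod f) <-> exists z, f *: z \notin N.
Proof.
move=> e_prim f_prim; rewrite -quot_actP.
by apply: comp_factor_idemP => //; apply: quot_ranked.
Qed.

(** Right multiplication by [a] has inverse right multiplication by [e * b * f], since [a * b'] is a
    nonzero idempotent of [f A f], hence [f]. *)
Lemma Pmod_iso (e f a b : A) :
  primitive_idempotent e -> primitive_idempotent f ->
  f * a * e = a -> b * a = e -> iso_mod (Pmod f) (Pmod e).
Proof.
move=> e_prim f_prim ae ba.
have [[ee e0 _] [ff _ _]] := (e_prim, f_prim).
have ae' : a * e = a by rewrite -ae -mulrA ee.
have fa : f * a = a by rewrite -ae !mulrA ff.
pose b' := e * b * f.
have b'a : b' * a = e by rewrite /b' -mulrA fa -mulrA ba ee.
have ab' : a * b' = f.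
  have [|||//] := @primitive_idem _ _ _ f_prim (a * b').
  - by rewrite /b' !mulrA fa -!mulrA ff.
  - by rewrite mulrA -(mulrA a) b'a ae'.
  by move=> ab0; case: e0;
    rewrite -ee -{1}b'a -mulrA -b'a (mulrA a) ab0 mul0r mulr0.
pose h (z : Pmod f) : Pmod e := pelem e (pval z * a).
have h_lin : linear h.
  by move=> c z w; apply: pval_inj;
    rewrite pvalD pvalZ /pval /= mulrDl mulrDl !mulrA.
pose hL := GRing.isLinear.Build A (Pmod f) (Pmod e) *:%R h h_lin.
pose h' : {linear Pmod f -> Pmod e} := HB.pack h hL.
exists h'; exists (fun w => pelem f (pval w * b')).
  move=> z; apply: pval_inj.
  transitivity (pval z * a * e * b' * f) => //.
  by rewrite -(mulrA _ a) ae' -(mulrA _ a) ab' !(pval_idem f_prim).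
move=> w; apply: pval_inj.
transitivity (pval w * b' * f * a * e) => //.
by rewrite -(mulrA _ f) fa -(mulrA _ b') b'a !(pval_idem e_prim).
Qed.

End CompositionFactors.

(** * Standard and proper standard modules *)

Section Standard.
Variables (k : fieldType) (A : falgType k) (n : nat) (e : 'I_n -> A).
Hypotheses (he : complete_primitive e) (hbasic : basic e).
Variable r : rel 'I_n.
Hypothesis hr : linear_order r.

Let e_prim i : primitive_idempotent (e i). Proof. by case: he. Qed.
Let ee i : e i * e i = e i. Proof. by case: (e_prim i). Qed.

Let prad_e i := prad (e_prim i).

Lemma simple_act (X : lmodType A) : simple_mod X ->
  exists j, exists x : X, e j *: x <> 0.
Proof.
move=> [[x x0] _]; apply: contrapT => nj; apply: x0.
have [_ _ e1] := he; rewrite -[x]scale1r -e1 scaler_suml big1 // => j _.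
by apply: contrapT => ejx; apply: nj; exists j, x.
Qed.

(** If [e j *: z] generated [Pmod (e i)], right multiplication by it would identify [Pmod (e j)]
    with [Pmod (e i)], against [hbasic]. *)
Lemma corner_prad i j (z : Pmod (e i)) : j != i -> e j *: z \in prad_e i.
Proof.
move=> /eqP ji; apply/mem_prad => b bz; apply/ji/hbasic.
apply: (@Pmod_iso _ _ (e i) (e j) (pval (e j *: z)) b) => //.
by rewrite pvalZ !mulrA ee -mulrA (pval_idem (e_prim i)).
Qed.

Definition Delta_cond i (M : lmodType A) :=
  forall j, comp_factor M (Smod (e j)) -> r j i.

Definition properDelta_cond i (M : lmodType A) :=
  comp_mult M (Smod (e i)) 1 /\
  forall j, j != i -> comp_factor M (Smod (e j)) -> r j i.

(** A series of the radical modulo [N] is extended by the top. As [e i] kills that radical,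
    [Smod (e i)] occurs only as the last factor. *)
Lemma comp_mult_top i (N : submod (Pmod (e i))) :
  {subset N <= prad_e i} -> (forall z, z \in prad_e i -> e i *: z \in N) ->
  comp_mult (quot_mod N) (Smod (e i)) 1.
Proof.
move=> N_rad rad_N; pose V := im_submod (quot_pi N) (prad_e i).
have memV z : (quot_pi N z \in V) = (z \in prad_e i).
  apply/asboolP/idP => [[w wJ /eqP]|zJ]; last by exists z.
  by rewrite -subr_eq0 -linearB quot_pi_eq0 => /N_rad zwJ;
    rewrite -(subrK w z) rpredD.
have [l [S serS]] := ranked_series V (quot_ranked N (e_prim i)).
have simpV : simple_mod (subquot (full_submod (quot_mod N)) V).
  apply/simple_subquotP => //; split.
    by exists (quot_pi N (pelem (e i) 1)); rewrite ?memV ?pelem1_notin_prad.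
  move=> W VW _.
  have [z zJ|WJ|WT] := (prad_maximal (e_prim i)).2 (preim_submod (quot_pi N) W).
  - by apply: VW; rewrite memV.
  - by left=> y; have [z ->] := quot_pi_surj y => zW; rewrite memV WJ.
  by right=> y _; have [z ->] := quot_pi_surj y; apply: WT.
have VT : {subset V <= full_submod (quot_mod N)} by [].
have serM := series_to_rcons serS VT simpV.
exists l.+1, (fun t => if (t <= l)%N then S t else full_submod _).
split; first exact/comp_seriesE.
rewrite (_ : [set _ | _] = [set ord_max]) ?cards1 //; apply/setP => t.
rewrite !inE; apply/asboolP/eqP => [isoS|->] /=.
  apply/eqP; rewrite -val_eqE /= eqn_leq -ltnS ltn_ord /= leqNgt;
    apply/negP => tl.
  rewrite tl (ltnW tl) in isoS.
  have [x xS] := (subquot_actP _ _ _).1 (iso_mod_act (iso_mod_sym isoS)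
    (top_idem (e_prim i))).
  have [_ Sl _] := serS.
  have xV : x \in V by rewrite -Sl; apply: (series_to_mono serS) xS;
    rewrite tl leqnn.
  have [z xz] := quot_pi_surj x; rewrite xz memV in xV.
  suff -> : e i *: x = 0 by rewrite rpred0.
  by rewrite xz -linearZ; apply/eqP; rewrite quot_pi_eq0 rad_N.
rewrite leqnn ltnn; have [_ Sl _] := serS.
have : exists x : subquot (full_submod (quot_mod N)) (S l), e i *: x <> 0.
  apply/subquot_actP; exists (quot_pi N (pelem (e i) 1)) => //.
  by rewrite -linearZ Sl memV (pelem1_idem (e_prim i)) pelem1_notin_prad.
case=> x; apply: (simple_iso_Smod (e_prim i)).
by apply: simple_subquot_ext simpV => // y; rewrite Sl.
Qed.

Lemma properDelta_condP i (N : submod (Pmod (e i))) :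
  {subset N <= prad_e i} -> (forall z, z \in prad_e i -> e i *: z \in N) ->
  (forall z j, ~~ r j i -> e j *: z \in N) -> properDelta_cond i (quot_mod N).
Proof.
move=> N_rad rad_N big_N; split; first exact: comp_mult_top.
move=> j _ /(comp_factor_quotP _ (e_prim i) (e_prim j))[z].
by apply: contraR => /big_N.
Qed.

Lemma properDelta_cond_prad i : properDelta_cond i (quot_mod (prad_e i)).
Proof.
have [r_refl _ _ _] := hr.
apply: properDelta_condP => // z; first by move=> zJ; apply: rpredZ.
by move=> j rji; apply: corner_prad; apply: contraNneq rji => ->.
Qed.

Definition Delta_ker i :=
  cap_submod (fun N : submod (Pmod (e i)) => Delta_cond i (quot_mod N)).
Definition properDelta_ker i :=
  cap_submod (fun N : submod (Pmod (e i)) => properDelta_cond i (quot_mod N)).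


Lemma Delta_homogeneous_properDelta_simple i :
  (forall X : lmodType A, comp_factor (Delta e r i) X -> iso_mod X (Smod (e
    i))) ->
  simple_mod (properDelta e r i) /\
  iso_mod (properDelta e r i) (Smod (e i)).
Proof.
move=> hom_Delta; have [r_refl _ _ _] := hr.
have kerE : properDelta_ker i =i prad_e i.
  (* The radical is a candidate, and every candidate turns out to be maximal, so their intersection
     is the radical. *)
  apply: cap_submod_least; first exact: properDelta_cond_prad.
  move=> N [multN facN].
  suff /maximal_prad eqN : maximal_submod N by move=> z; rewrite eqN.
  apply/simple_quotP; have DN : Delta_cond i (quot_mod N).
    by move=> j; have [->|/facN] := eqVneq j i.
  have [l [S [serS cardS]]] := multN; have [S0 ST step] := serS.
  (* A factor [Smod (e j)] puts some [e j *: z] outside [N], hence outside the smaller kernel of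
     [Delta e r i], so it is a factor of [Delta e r i] as well. *)
  have all_iso (t : 'I_l) : iso_mod (subquot (S t.+1) (S t)) (Smod (e i)).
    have [_ simpS] := step t (ltn_ord t).
    have [j [x ejx]] := simple_act simpS.
    apply: iso_mod_trans (simple_iso_Smod (e_prim j) simpS ejx) _.
    apply: hom_Delta; apply/(comp_factor_quotP _ (e_prim i) (e_prim j)).
    have [y _ ejy] : exists2 y, y \in S t.+1 & e j *: y \notin S t.
      by apply/subquot_actP; exists x.
    have [z ejz] : exists z, e j *: z \notin N.
      by apply/quot_actP; exists y => ey0; rewrite ey0 rpred0 in ejy.
    by exists z; apply: contra ejz => /asboolP; apply.
  have l1 : l = 1%N.
    rewrite -cardS -[l in LHS]card_ord -cardsT; apply: eq_card => t.
    by rewrite !inE; apply/esym/asboolP.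
  rewrite l1 in ST step; have [_] := step 0%N isT.
  by rewrite simple_subquot_full.
have simp : simple_mod (properDelta e r i).
  by apply/simple_quotP/(maximal_prad (e_prim i)).
split=> //.
have [x ex] : exists x : properDelta e r i, e i *: x <> 0.
  apply/quot_actP; exists (pelem (e i) 1).
  by rewrite kerE (pelem1_idem (e_prim i)) pelem1_notin_prad.
exact: simple_iso_Smod ex.
Qed.

Lemma directed_Delta_homogeneous i :
  (forall j, (exists a, e j * a * e i <> 0) -> r i j) ->
  forall X : lmodType A, comp_factor (Delta e r i) X -> iso_mod X (Smod (e i)).
Proof.
move=> dir X [l [S [[S0 ST step] [t tl isoX]]]].
have [_ r_anti _ _] := hr.
have [_ simpS] := step t tl; have [j [x ejx]] := simple_act simpS.
apply: iso_mod_trans (iso_mod_sym isoX) _.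
have isoS := simple_iso_Smod (e_prim j) simpS ejx.
suff ji : j = i by rewrite ji in isoS.
have [y _ ejy] : exists2 y, y \in S t.+1 & e j *: y \notin S t.
  by apply/subquot_actP; exists x.
have [z ejz] : exists z, e j *: z \notin Delta_ker i.
  by apply/quot_actP; exists y => ey0; rewrite ey0 rpred0 in ejy.
apply/r_anti/andP; split.
  (* [Delta_ker i] is an intersection, so some quotient satisfying [Delta_cond i] already has the
     factor [Smod (e j)]. *)
  have [N DN zN] : exists2 N :
    submod (Pmod (e i)), Delta_cond i (quot_mod N) & e j *: z \notin N.
    apply: contrapT => nN; case/negP: ejz; apply/asboolP => N DN.
    by apply: contrapT => /negP zN; apply: nN; exists N.
  by apply: DN; apply/comp_factor_quotP => //; exists z.
apply: dir.
exists (pval z); rewrite -mulrA (pval_idem (e_prim i)) => ez0; case/negP: ejz.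
by rewrite (_ : e j *: z = 0) ?rpred0 //; apply: pval_inj; rewrite pvalZ.
Qed.

Lemma properDelta_simple_directed :
  (forall i, simple_mod (properDelta e r i)) ->
  forall i j, r j i -> j != i -> forall a, e j * a * e i = 0.
Proof.
move=> simpD; have [r_refl r_anti r_trans r_total] := hr.
(* By totality the set counted here consists of the indices strictly above [i]. *)
suff main m i : (#|[pred l | ~~ r l i]| < m)%N ->
    forall j, r j i -> j != i -> forall a, e j * a * e i = 0.
  by move=> i; apply: main (ltnSn _).
elim: m i => // m IH i im j rji ji a.
(* Fewer indices lie above [l] than above [i], as [l] itself drops out, and [j] is strictly below
   [l]. *)
have zero_l l b : ~~ r l i -> e j * b * e l = 0.
  move=> rli; have ril : r i l by have := r_total i l; rewrite (negPf rli) orbF.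
  apply: IH (r_trans _ _ _ rji ril) _ b; last first.
    by apply: contraNneq rli => <-.
  rewrite -ltnS; apply: leq_trans im; apply/proper_card/properP; split.
    by apply/subsetP => p; rewrite !inE; apply: contra => rpi;
      apply: (r_trans _ _ _ rpi ril).
  by exists l; rewrite !inE ?r_refl.
(* A [k]-basis of the corner also generates it as a right module over [e i A e i]. *)
pose s := vbasis (corner e i j).
have s_corner w : w \in s -> exists b, w = e j * b * e i.
  by move=> /vbasis_mem/cornerP.
(* Quantifying over all [b] makes the condition stable under left multiplication by [A]. *)
have comb_closed : submod_closed [pred z : Pmod (e i) |
    (z \in prad_e i) && `[< forall b, rad_comb (e i) s (e j * b * pval z) >]].
  split=> [|b z w /andP[zJ /asboolP zs] /andP[wJ /asboolP ws]].
    apply/andP; split; first exact: rpred0.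
    by apply/asboolP=> b; rewrite [pval 0]/(0 : A) mulr0; apply: rad_comb0.
  apply/andP; split; first by rewrite rpredD ?rpredZ.
  apply/asboolP=> c; rewrite pvalD pvalZ mulrDr mulrA -(mulrA (e j)).
  exact: rad_combD.
pose N := Submod comb_closed.
have N_cond : properDelta_cond i (quot_mod N).
  apply: properDelta_condP.
  - by move=> z /andP[].
  - move=> z zJ; apply/andP; split; first by rewrite rpredZ.
    apply/asboolP=> b; rewrite pvalZ.
    have -> : e j * b * (e i * pval z) = (e j * b * e i) * (e i * pval z).
      by rewrite -!mulrA (mulrA (e i)) ee.
    apply: rad_comb_span => //.
      by rewrite (span_basis (vbasisP _)); apply/cornerP; exists b.
    split; first by rewrite !mulrA ee -mulrA pval_idem.
    by move=> c; rewrite mulrA; move: (c * e i); apply/mem_prad.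
  move=> z l rli; apply/andP; split.
    by apply: corner_prad; apply: contraNneq rli => ->.
  apply/asboolP=> b; rewrite pvalZ mulrA zero_l // mul0r; exact: rad_comb0.
have s0 : forall w, w \in s -> w = 0.
  apply: (rad_comb_nakayama (e_prim i)) => w /s_corner[b ->].
    by rewrite -mulrA ee.
  (* This element is in the radical, which by simplicity is the kernel of [properDelta e r i] and so
     lies in the candidate [N]; the multiplier [1] then recovers the generator. *)
  have : e j *: pelem (e i) b \in properDelta_ker i.
    have /simple_quotP/maximal_prad -> := simpD i.
    exact: corner_prad.
  move=> /asboolP/(_ N N_cond)/andP[_ /asboolP/(_ 1)].
  by rewrite mulr1 pvalZ mulrA ee mulrA.
have : (<<s>> <= 0)%VS by apply/span_subvP => w /s0->; rewrite mem0v.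
rewrite (span_basis (vbasisP _)) => /subvP/(_ (e j * a * e i)).
by rewrite memv0 => /(_ _)/eqP-> //; apply/cornerP; exists a.
Qed.

End Standard.

Theorem proposition3p2 (k : closedFieldType) (A : falgType k) (n : nat)
    (e : 'I_n -> A) (he : complete_primitive e) (hbasic : basic e)
    (r : rel 'I_n) (hr : linear_order r) :
  [<-> forall (i : 'I_n) (X : lmodType A),
         comp_factor (Delta e r i) X -> iso_mod X (Smod (e i));
       forall i : 'I_n,
         simple_mod (properDelta e r i) /\
         iso_mod (properDelta e r i) (Smod (e i));
       directed (associated_category he) r].
Proof.
tfae=> [hom i|simp i j [f f0]|dir i].
- exact: Delta_homogeneous_properDelta_simple (hom i).
- have [r_refl _ _ r_total] := hr.
  (* If [r i j] fails, totality puts [j] strictly below [i], where the corner vanishes. *)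
  case: (boolP (r i j)) => // rij; case: f0; apply: val_inj => /=.
  have /cornerP[a ->] := subvsP f.
  apply: (properDelta_simple_directed he hbasic hr) => [l||].
  + by have [] := simp l.
  + by have := r_total i j; rewrite (negPf rij).
  by apply: contraNneq rij => ->.
apply: directed_Delta_homogeneous => // j [a ea0]; apply: dir.
have eaP : e j * a * e i \in corner e i j by apply/cornerP; exists a.
by exists (Subvs eaP) => /(congr1 val).
Qed.
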